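(* Let $R$ be a real closed field equipped with an o-minimal structure expanding $R$. Let $X$ and $Y$ be definable sets, with $X\subset R^n$ locally closed, and let $f:X\to Y$ be a continuous definable map. Then $\widehat f:\widehat X\to\widehat Y$ is continuous.
   Context: An o-minimal structure expanding a real closed field $R$ is a collection of Boolean algebras $\mathcal S^n$ of subsets of $R^n$ ($n\in\mathbb N$) containing all algebraic subsets, closed under Cartesian products and coordinate projections $R^{n+1}\to R^n$, such that elements of $\mathcal S^1$ are finite unions of points and open intervals. Members are called definable sets; a function is definable if its graph is. For a definable set $X\subset R^n$, $\widetilde X$ denotes the set of germs at $0\in R$ of continuous definable functions from $(0,\infty)$ to $X$ (continuous definable maps $(0,\epsilon)\to X$, identified when they agree on some $(0,\epsilon')$). $\widetilde R$ is a real closed field under pointwise operations, in which $\gamma\ge0$ iff $\gamma(t)\ge0$ for all small $t>0$; $\widetilde R^n$ carries its Euclidean topology, with basis the open balls $\{\delta:|\delta-\gamma|<r\}$, $r\in\widetilde R$, $r>0$, and subsets of $\widetilde R^n$ carry the induced topology. For a definable map $f:X\to Y$, $\widetilde f:\widetilde X\to\widetilde Y$ is $\widetilde f(\gamma)=f\circ\gamma$. For a definable set $M$, $\widehat M=\{\gamma\in\widetilde M:\lim_{t\to0^+}\gamma(t)\in M\}$ (the limit exists and lies in $M$), and for a continuous definable map $f:M\to N$, $\widehat f:\widehat M\to\widehat N$ is the restriction of $\widetilde f$ to $\widehat M$. *)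

(* Defs.v *)
From HB Require Import structures.
From mathcomp Require Import all_boot all_order all_algebra.
From mathcomp Require Import -(notations) mpoly.
From mathcomp Require Import all_classical topology normedtype.
From mathcomp Require Import lra.

Set Implicit Arguments.
Unset Strict Implicit.
Unset Printing Implicit Defensive.

Import Order.TTheory GRing.Theory Num.Theory.
Import numFieldNormedType.Exports.

Local Open Scope classical_set_scope.
Local Open Scope ring_scope.
Local Open Scope quotient_scope.

Definition algebraic (R : rcfType) n (A : set 'rV[R]_n) :=
  exists k (p : 'I_k -> mpoly n R),
    A = [set x | forall i, meval (fun j => x 0 j) (p i) = 0].

Variant point_or_open_interval (R : rcfType) : set R -> Prop :=
| Point a : point_or_open_interval [set a]
| OpenBounded a b : point_or_open_interval `]a, b[
| OpenRight a : point_or_open_interval `]a, +oo[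
| OpenLeft b : point_or_open_interval `]-oo, b[
| OpenLine : point_or_open_interval `]-oo, +oo[.

Record omin (R : rcfType) := OMin {
  definable : forall n, set (set 'rV[R]_n);
  definable0 : forall n, definable (set0 : set 'rV[R]_n);
  definableC : forall n (A : set 'rV[R]_n), definable A -> definable (~` A);
  definableU : forall n (A B : set 'rV[R]_n),
    definable A -> definable B -> definable (A `|` B);
  definable_algebraic : forall n (A : set 'rV[R]_n),
    algebraic A -> definable A;
  definableX : forall m n (A : set 'rV[R]_m) (B : set 'rV[R]_n),
    definable A -> definable B ->
    definable [set row_mx a b | a in A & b in B];
  definable_proj : forall n (j : 'I_n.+1) (A : set 'rV[R]_n.+1),
    definable A -> definable ([set col' j x | x in A] : set 'rV[R]_n);
  definable_tame : forall A : set 'rV[R]_1, definable A ->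
    exists k (F : 'I_k -> set R), (forall i, point_or_open_interval (F i)) /\
      [set x 0 0 | x in A] = \bigcup_i F i
}.

Section DefinableMaps.
Context {R : rcfType} (S : omin R).

(* A map X -> Y is given by a total function of which only the restriction to
   [X] matters. *)
Definition cont_definable_map n m (X : set 'rV[R]_n) (Y : set 'rV[R]_m)
    (f : 'rV[R]_n -> 'rV[R]_m) :=
  [/\ forall x, X x -> Y (f x),
      {within X, continuous f} &
      definable S [set row_mx x (f x) | x in X]].

Definition cont_definable_on n (e : R) (c : R -> 'rV[R]_n) :=
  {in `]0, e[, continuous c} /\
  definable S [set row_mx t%:M (c t) | t in `]0, e[].

Let definable_eq n (A B : set 'rV[R]_n) :
  A = B -> definable S A -> definable S B.
Proof. by move=> ->. Qed.

Lemma definableI n (A B : set 'rV[R]_n) : 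
  definable S A -> definable S B -> definable S (A `&` B).
Proof.
move=> SA SB; rewrite -[A `&` B]setCK setCI.
by apply: definableC; apply: definableU; exact: definableC.
Qed.

Lemma definableT n : definable S (setT : set 'rV[R]_n).
Proof. by rewrite -setC0; apply/definableC/definable0. Qed.

Lemma row_mxA1 n m (t : 'rV[R]_1) (x : 'rV[R]_n) (y : 'rV[R]_m) :
  row_mx t (row_mx x y) = row_mx (row_mx t x) y :> 'rV_(1 + (n + m)).
Proof. by rewrite row_mxA; exact: castmx_id. Qed.

Lemma definable_proj_mid n m (C : set 'rV[R]_(1 + (n + m))) :
  definable S C ->
  definable S ([set w | exists t x y,
     C (row_mx t (row_mx (x : 'rV_n) y)) /\ w = row_mx t y] : set 'rV[R]_(1 + m)).
Proof.
elim: n C => [|n IHn] C SC.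
  suff -> : [set w | exists t x y,
      C (row_mx t (row_mx (x : 'rV_0) y)) /\ w = row_mx t y] = C by [].
  have r0 (x : 'rV[R]_0) (y : 'rV[R]_m) : row_mx x y = y :> 'rV_(0 + m).
    apply/rowP => i; rewrite mxE; case: splitP => [[]//|k ik].
    by congr (y _ _); apply: val_inj.
  apply/seteqP; split=> [w [t [x [y [Cw ->]]]]|w Cw].
    by move: Cw; rewrite r0.
  by exists (lsubmx w), 0, (rsubmx (w : 'rV_(1 + m))); rewrite r0 hsubmxK.
pose j : 'I_(1 + (n.+1 + m)) := rshift 1 (lshift m (ord0 : 'I_n.+1)).
have colE (t : 'rV[R]_1) (x : 'rV[R]_n.+1) (y : 'rV[R]_m) :
    col' j (row_mx t (row_mx x y)) = row_mx t (row_mx (col' ord0 x) y)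
      :> 'rV_(1 + (n + m)).
  apply/rowP => i; rewrite !mxE.
  rewrite -(col'Kl (ord0 : 'I_n.+1) x y).
  case: (@splitP 1 (n + m) i) => [a ia|a ia].
    case: splitP => [b ib|b ib]; first by rewrite !ord1.
    by move: ib; rewrite /= /bump ia (ord1 a).
  case: splitP => [b ib|b ib].
    by move: ib; rewrite /= /bump ia (ord1 b).
  rewrite [RHS]mxE; congr (row_mx x y _ _); apply: val_inj => /=.
  by move: ib; rewrite /= /bump ia /= !add1n => -[<-].
apply: definable_eq (IHn _ (definable_proj j SC)).
apply/seteqP; split=> w.
  move=> [t [x' [y [[z Cz zE] ->]]]].
  pose z' : 'rV[R]_(1 + (n.+1 + m)) := z.
  pose t' : 'rV[R]_1 := lsubmx z'.
  pose x : 'rV[R]_n.+1 := lsubmx (rsubmx z').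
  pose y' : 'rV[R]_m := rsubmx (rsubmx z').
  have zE' : z' = row_mx t' (row_mx x y') by rewrite !hsubmxK.
  move: zE; rewrite -[z]/z' zE' colE => /(@eq_row_mx _ 1 1 (n + m))[tt'] /eq_row_mx[_ yy'].
  by exists t', x, y'; rewrite -zE' /z' tt' yy'.
move=> [t [x [y [Cw ->]]]]; exists t, (col' ord0 x), y; split=> //.
by exists (row_mx t (row_mx x y)).
Qed.

Lemma definable_itv0 (e : R) : 0 < e ->
  definable S [set (t%:M : 'rV_1) | t in `]0, e[].
Proof.
move=> e0.
pose X0 : mpoly 2 R := mpolyX R (mnm1 (ord0 : 'I_2)).
pose X1 : mpoly 2 R := mpolyX R (mnm1 (ord_max : 'I_2)).
pose p := X0 * (mpolyC 2 e - X0) * X1 ^+ 2 - mpolyC 2 1.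
have pE (x : 'rV[R]_2) : meval (fun j => x 0 j) p =
    x 0 ord0 * (e - x 0 ord0) * x 0 ord_max ^+ 2 - 1.
  by rewrite /p !expr2 !(mevalB, mevalM) !mevalC !mevalXU.
have SA : definable S [set x : 'rV_2 | meval (fun j => x 0 j) p = 0].
  apply: definable_algebraic; exists 1%N, (fun=> p).
  by apply/seteqP; split=> x //=; apply; exact: ord0.
apply: definable_eq (definable_proj (ord_max : 'I_2) SA).
apply/seteqP; split=> [_ [x /= + <-]|_ [t /= + <-]].
  rewrite pE => px; exists (x 0 ord0); last first.
    apply/rowP => i; rewrite !mxE (ord1 i) eqxx mulr1n; congr (x _ _).
    exact: val_inj.
  have {}px : x 0 ord0 * (e - x 0 ord0) * x 0 ord_max ^+ 2 = 1 by lra.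
  rewrite /= in_itv /=.
  have : 0 < x 0 ord0 * (e - x 0 ord0).
    rewrite ltNge; apply/negP => le0.
    by have := mulr_le0_ge0 le0 (sqr_ge0 (x 0 ord_max)); rewrite px ler10.
  set u := x 0 ord0; set v := e - u.
  move=> uv0; have [u0|u0|u0] := ltgtP 0 u.
  - by move: uv0; rewrite pmulr_rgt0// /v subr_gt0.
  - move: uv0; rewrite nmulr_rgt0// /v subr_lt0 => eu.
    by have := lt_trans eu u0; rewrite ltNge (ltW e0).
  - by move: uv0; rewrite -u0 mul0r ltxx.
rewrite in_itv /= => /andP[t0 te].
have te0 : 0 < t * (e - t) by rewrite mulr_gt0// subr_gt0.
pose x : 'rV[R]_2 := \row_i (if i == ord0 then t else (Num.sqrt (t * (e - t)))^-1).
exists x.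
  rewrite /= pE !mxE /= exprVn sqr_sqrtr ?(ltW te0)//.
  by rewrite mulfV ?subrr// gt_eqF.
by apply/rowP => i; rewrite !mxE (ord1 i) eqxx mulr1n.
Qed.

Lemma cont_definable_on_comp n m (X : set 'rV[R]_n) (Y : set 'rV[R]_m)
    f (c : R -> 'rV[R]_n) (e e' : R) :
  cont_definable_map X Y f -> cont_definable_on e c ->
  0 < e' -> e' <= e -> (forall t, t \in `]0, e'[ -> X (c t)) ->
  cont_definable_on e' (f \o c).
Proof.
move=> [fXY fcont fdef] [ccont cdef] e'0 e'e cX.
have sub t : t \in `]0, e'[ -> t \in `]0, e[.
  by rewrite !in_itv /= => /andP[-> /= te]; exact: lt_le_trans te e'e.
split=> [t te|].
  have Xct := cX _ te.
  have /(_ (c t) Xct) fct := (subspace_continuousP X f).1 fcont.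
  apply: cvg_comp fct => U; rewrite /within /= => XU.
  have /(_ _ XU) := ccont _ (sub _ te); rewrite !near_simpl /= => cU.
  have tnear : \forall s \near t, s \in `]0, e'[.
    by apply: near_in_itvoo.
  by near=> s; apply: (near cU) => //; apply: cX; near: s.
pose A := [set row_mx a b | a in [set row_mx t%:M (c t) | t in `]0, e[] &
                            b in (setT : set 'rV[R]_m)].
pose B := [set row_mx a b | a in [set (t%:M : 'rV[R]_1) | t in `]0, e'[] &
                            b in [set row_mx x (f x) | x in X]].
have SA : definable S A by apply: definableX => //; exact: definableT.
have SB : definable S B by apply: definableX => //; exact: definable_itv0.
have SAB := @definableI (1 + (n + m))%N A B SA SB.
apply: definable_eq (definable_proj_mid SAB); apply/seteqP; split=> w /=.
  move=> [t [x [y [[[_ [s se <-] [y' _ Ey]] [_ [s' s'e <-] [_ [x' Xx' <-] Ex]]] ->]]]].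
  move: Ey; rewrite row_mxA1 => /(@eq_row_mx _ 1 (1 + n) m)[].
  move=> /(@eq_row_mx _ 1 1 n)[st cx] _.
  move: Ex => /(@eq_row_mx _ 1 1 (n + m))[s't /eq_row_mx[xx' fy]].
  have ss' : s = s'.
    by move: st; rewrite -s't => /rowP/(_ 0); rewrite !mxE eqxx !mulr1n.
  by exists s' => //; rewrite s't -fy xx' -cx ss'.
move=> [t te <-]; exists t%:M, (c t), (f (c t)); split=> //; split.
  exists (row_mx t%:M (c t)); first by exists t => //; exact: sub.
  by exists (f (c t)) => //; rewrite row_mxA1.
exists t%:M; first by exists t.
by exists (row_mx (c t) (f (c t))) => //; exists (c t) => //; exact: cX.
Unshelve. all: by end_near. Qed.

Record curve n := Curve {
  curve_fun :> R -> 'rV[R]_n;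
  curveP : exists2 e, 0 < e & cont_definable_on e curve_fun
}.

HB.instance Definition _ n := gen_eqMixin (curve n).
HB.instance Definition _ n := gen_choiceMixin (curve n).

Definition curve_eq n (c d : curve n) := `[< \forall t \near 0^'+, c t = d t >].

Lemma curve_eq_equiv n : equiv_class_of (@curve_eq n).
Proof.
split=> [c|c d|d c b].
- by apply/asboolP; near=> t.
- by apply/asboolP/asboolP; apply: filterS => t ->.
- move=> /asboolP cd /asboolP db; apply/asboolP.
  by apply: filterS2 cd db => t ->.
Unshelve. all: by end_near. Qed.

Canonical curve_equiv n := EquivRelPack (@curve_eq_equiv n).

(* [germ n] is R~^n, identified with the germs of curves in R^n; [germ 1] is R~. *)
Definition germ n := {eq_quot (curve_equiv n)}.

HB.instance Definition _ n := Choice.on (germ n).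

Definition germ_fun n (g : germ n) : R -> 'rV[R]_n := repr g.

Definition enorm n (x : 'rV[R]_n) : R := Num.sqrt (\sum_i x 0 i ^+ 2).

(* The strict order of R~ on germs of functions: eventually [u <= v], and the
   germs of [u] and [v] differ. *)
Definition germ_lt (u v : R -> R) :=
  (\forall t \near 0^'+, u t <= v t) /\ ~ (\forall t \near 0^'+, u t = v t).

Definition germ_ball n (c : germ n) (r : germ 1) : set (germ n) :=
  [set d | germ_lt (fun t => enorm (germ_fun d t - germ_fun c t))
                   (fun t => germ_fun r t 0 0)].

Definition germ_balls n : set (set (germ n)) :=
  [set B | exists c r,
     germ_lt (fun=> 0) (fun t => germ_fun r t 0 0) /\ B = germ_ball c r].

(* The balls form a basis, so the topology they generate as a subbasis is the
   Euclidean one. *)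
HB.instance Definition _ n :=
  isSubBaseTopological.Build (germ n) (germ_balls (n := n)) id.

Definition tilde n (X : set 'rV[R]_n) : set (germ n) :=
  [set g | \forall t \near 0^'+, X (germ_fun g t)].

Definition hat n (X : set 'rV[R]_n) : set (germ n) :=
  [set g | tilde X g /\ exists2 x, X x & germ_fun g t @[t --> 0^'+] --> x].

Lemma germ_funP n (c : curve n) :
  \forall t \near 0^'+, germ_fun (\pi_(germ n) c) t = c t.
Proof. by have /eqmodP/asboolP := reprK (\pi_(germ n) c). Qed.

Section Functoriality.
Context n m (X : set 'rV[R]_n) (Y : set 'rV[R]_m) (f : 'rV[R]_n -> 'rV[R]_m).
Hypothesis hf : cont_definable_map X Y f.

Lemma tilde_comp_subproof (g : germ n) : tilde X g ->
  exists2 e, 0 < e & cont_definable_on e (f \o germ_fun g).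
Proof.
move=> [d /= d0 dX]; have [e e0 ce] := curveP (repr g).
pose e' := Num.min d e.
have e'0 : 0 < e' by rewrite lt_min d0.
exists e' => //; apply: (cont_definable_on_comp hf ce) => //.
  by rewrite ge_min lexx orbT.
move=> t; rewrite in_itv /= lt_min => /andP[t0 /andP[td _]].
by apply: dX => //=; rewrite sub0r normrN gtr0_norm.
Qed.

Definition tilde_comp (g : germ n) (gX : tilde X g) : germ m :=
  \pi_(germ m) (Curve (tilde_comp_subproof gX)).

Lemma tilde_compE (g : germ n) (gX : tilde X g) :
  \forall t \near 0^'+, germ_fun (tilde_comp gX) t = f (germ_fun g t).
Proof. exact: germ_funP. Qed.

Lemma tilde_compP (g : germ n) (gX : tilde X g) : tilde Y (tilde_comp gX).
Proof.
have [fXY _ _] := hf; have gX' := gX.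
by apply: filterS2 (tilde_compE gX) gX' => t -> /fXY.
Qed.

Definition tilde_map (g : tilde X) : tilde Y :=
  SigSub (mem_set (tilde_compP (set_mem (valP g)))).

Lemma hat_tilde (g : germ n) : hat X g -> tilde X g.
Proof. by case. Qed.

Definition hat_incl (g : hat X) : tilde X :=
  SigSub (mem_set (hat_tilde (set_mem (valP g)))).

Lemma hat_mapP (g : hat X) : hat Y (val (tilde_map (hat_incl g))).
Proof.
have [fXY fcont _] := hf.
split; first exact: set_mem (valP (tilde_map _)).
have [gX [x Xx gx]] := set_mem (valP g).
exists (f x); first exact: fXY.
have fx := (subspace_continuousP X f).1 fcont x Xx.
have fg : f (germ_fun (val g) t) @[t --> 0^'+] --> f x.
  apply: cvg_comp fx => U; rewrite /within /= => XU.
  have /= gU := gx _ XU.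
  by apply: filterS2 gX gU => t Xt; apply.
apply: cvg_trans fg; apply: near_eq_cvg.
by apply: filterS (tilde_compE (set_mem (valP (hat_incl g)))) => t /= ->.
Qed.

Definition hat_map (g : hat X) : hat Y := SigSub (mem_set (hat_mapP g)).

End Functoriality.
End DefinableMaps.

Definition locally_closed (T : topologicalType) (X : set T) :=
  exists U F, [/\ open U, closed F & X = U `&` F].

(* Main.v *)
Require Import Defs.
From mathcomp Require Import all_boot all_order all_algebra.
From mathcomp Require Import -(notations) mpoly.
From mathcomp Require Import finmap.
From mathcomp Require Import all_classical topology normedtype.
From mathcomp Require Import lra ring.
Import Order.TTheory GRing.Theory Num.Theory.
Import numFieldNormedType.Exports.

Set Implicit Arguments.
Unset Strict Implicit.
Unset Printing Implicit Defensive.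

Local Open Scope classical_set_scope.
Local Open Scope ring_scope.
Local Open Scope quotient_scope.

(* Let the image of a germ g lie in the open ball of center c and radius r.
   For each small t consider the rho in (0, 1] such that
     |f b - c(t)| <= r(t) - rho  for all b in X with |b - g(t)| < rho.
   There is one because f is continuous at g(t), and their supremum sigma(t)
   exists because definable subsets of R are finite unions of points and
   intervals.  If rho is admissible at t, then rho minus
   |g(s) - g(t)| + |c(s) - c(t)| + |r(s) - r(t)| is admissible at s; hence sigma
   is continuous and sigma / 2 is a germ.  The ball of center g and radius
   sigma / 2 is mapped into the given ball. *)

(** * Polynomial maps and definability *)

Section PolynomialMaps.
Context {R : rcfType}.

Definition polyfun n (u : 'rV[R]_n -> R) :=
  exists p : mpoly n R, forall x, u x = meval (fun j => x 0 j) p.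

Definition polymap n m (u : 'rV[R]_n -> 'rV[R]_m) :=
  forall j, polyfun (fun x => u x 0 j).

Lemma polyfun_cst n (a : R) : polyfun (fun _ : 'rV[R]_n => a).
Proof. by exists (mpolyC n a) => x; rewrite mevalC. Qed.

Lemma polyfun_coord n j : polyfun (fun x : 'rV[R]_n => x 0 j).
Proof. by exists (mpolyX R (mnm1 j)) => x; rewrite mevalXU. Qed.

Lemma polyfunB n (u v : 'rV[R]_n -> R) :
  polyfun u -> polyfun v -> polyfun (fun x => u x - v x).
Proof. by move=> [p pE] [q qE]; exists (p - q) => x; rewrite mevalB pE qE. Qed.

Lemma polyfunM n (u v : 'rV[R]_n -> R) :
  polyfun u -> polyfun v -> polyfun (fun x => u x * v x).
Proof. by move=> [p pE] [q qE]; exists (p * q) => x; rewrite mevalM pE qE. Qed.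

Lemma polyfunX2 n (u : 'rV[R]_n -> R) :
  polyfun u -> polyfun (fun x => u x ^+ 2).
Proof. by move=> pu; apply: polyfunM. Qed.

Lemma polyfun_sum n k (u : 'I_k -> 'rV[R]_n -> R) :
  (forall i, polyfun (u i)) -> polyfun (fun x => \sum_i u i x).
Proof.
move=> /(_ _)/cid pu; exists (\sum_i sval (pu i)) => x.
by rewrite raddf_sum; apply: eq_bigr => i _; case: (pu i).
Qed.

Lemma polymap_entry n m (u : 'rV[R]_n -> 'rV[R]_m) i j :
  polymap u -> polyfun (fun x => u x i j).
Proof. by rewrite (ord1 i); apply. Qed.

Lemma polymap_id n : polymap (fun x : 'rV[R]_n => x).
Proof. by move=> j; exact: polyfun_coord. Qed.

Lemma polymap_lsub k n m (u : 'rV[R]_k -> 'rV[R]_(n + m)) :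
  polymap u -> polymap (fun x => lsubmx (u x)).
Proof.
move=> pu j; have [p pE] := pu (lshift m j).
by exists p => x; rewrite mxE pE.
Qed.

Lemma polymap_rsub k n m (u : 'rV[R]_k -> 'rV[R]_(n + m)) :
  polymap u -> polymap (fun x => rsubmx (u x)).
Proof.
move=> pu j; have [p pE] := pu (rshift n j).
by exists p => x; rewrite mxE pE.
Qed.

Lemma polymap_row k n m (u : 'rV[R]_k -> 'rV[R]_n) (v : 'rV[R]_k -> 'rV[R]_m) :
  polymap u -> polymap v -> polymap (fun x => row_mx (u x) (v x)).
Proof.
move=> pu pv j; have [p pE] : polyfun (fun x => match fintype.split j with
    inl i => u x 0 i | inr i => v x 0 i end) by case: (fintype.split j).
by exists p => x; rewrite -pE mxE; case: splitP.
Qed.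

Lemma polymap_const n (u : 'rV[R]_n -> R) :
  polyfun u -> polymap (fun x => const_mx (u x) : 'rV_1).
Proof. by move=> [p pE] j; exists p => x; rewrite mxE pE. Qed.

(** Substitute the last [n] of the [m + n] variables into the polynomial. This makes the graph of a
    polynomial map algebraic in the product space. *)
Lemma polyfun_rsub m n (u : 'rV[R]_n -> R) :
  polyfun u -> polyfun (fun z : 'rV[R]_(m + n) => u (rsubmx z)).
Proof.
move=> [p pE].
exists (comp_mpoly [tuple mpolyX R (mnm1 (rshift m j)) | j < n] p) => x.
rewrite comp_mpoly_meval pE; apply: mpoly.meval_eq => j.
by rewrite tnth_mktuple mevalXU mxE.
Qed.

End PolynomialMaps.

(** * First-order operations on definable sets *)

Section Definability.
Context {R : rcfType} (S : omin R).

Lemma definable_eq n (A B : set 'rV[R]_n) :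
  A = B -> definable S A -> definable S B.
Proof. by move=> ->. Qed.

(** [definable_proj_mid] eliminates a block of variables lying behind one leading coordinate. So a
    dummy coordinate is put in front, the block is projected away, and the dummy is projected away
    last. *)
Lemma definable_ex m n (C : 'rV[R]_m -> 'rV[R]_n -> Prop) :
  definable S [set z : 'rV_(m + n) | C (lsubmx z) (rsubmx z)] ->
  definable S [set x | exists y, C y x].
Proof.
move=> SC.
have SD := definable_proj_mid (definableX (definableT S 1) SC).
apply: definable_eq (definable_proj (ord0 : 'I_n.+1) SD).
have colE (t : 'rV[R]_1) (x : 'rV[R]_n) : col' ord0 (row_mx t x : 'rV_n.+1) = x.
  apply/rowP => i; rewrite mxE -[RHS](row_mxEr t).
  by congr (row_mx _ _ _ _); exact: val_inj.
apply/seteqP; split=> [_ [_ [t [y [x [[t' _ [z zC zE]] ->]]]] <-]|x [y yx]].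
  rewrite colE; exists y; move: zE => /(@eq_row_mx _ 1 1 (m + n)) [_ zE].
  by move: zC; rewrite /= zE row_mxKl row_mxKr.
exists (row_mx (0 : 'rV[R]_1) x); last exact: colE.
exists 0, y, x; split=> //; exists 0 => //; exists (row_mx y x) => //=.
by rewrite row_mxKl row_mxKr.
Qed.

Lemma definable_not n (A : 'rV[R]_n -> Prop) :
  definable S [set x | A x] -> definable S [set x | ~ A x].
Proof. exact: definableC. Qed.

Lemma definable_and n (A B : 'rV[R]_n -> Prop) :
  definable S [set x | A x] -> definable S [set x | B x] ->
  definable S [set x | A x /\ B x].
Proof. exact: definableI. Qed.

Lemma definable_imp n (A B : 'rV[R]_n -> Prop) :
  definable S [set x | A x] -> definable S [set x | B x] ->
  definable S [set x | A x -> B x].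
Proof.
move=> SA SB; apply: definable_eq (definableU (definableC SA) SB).
apply/seteqP; split=> x /=; first by case.
by move=> AB; have [/AB|] := pselect (A x); [right|left].
Qed.

Lemma definable_all m n (C : 'rV[R]_m -> 'rV[R]_n -> Prop) :
  definable S [set z : 'rV_(m + n) | C (lsubmx z) (rsubmx z)] ->
  definable S [set x | forall y, C y x].
Proof.
move=> /definable_not/(@definable_ex _ _ (fun y x => ~ C y x))/definable_not.
apply: definable_eq; apply/seteqP; split=> x /=; last by move=> Cx [y]; apply.
by move=> nC y; apply: contrapT => nCy; apply: nC; exists y.
Qed.

Lemma definable_zero n k (u : 'I_k -> 'rV[R]_n -> R) :
  (forall i, polyfun (u i)) -> definable S [set x | forall i, u i x = 0].
Proof.
move=> /(_ _)/cid pu; apply: definable_algebraic.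
exists k, (fun i => sval (pu i)).
by apply/seteqP; split=> x + i => /(_ i); case: (pu i) => p /= ->.
Qed.

(** The preimage is the projection of [A] times the whole space, intersected with the graph of [u],
    which is algebraic. *)
Lemma definable_preimage n m (A : set 'rV[R]_m) (u : 'rV[R]_n -> 'rV[R]_m) :
  definable S A -> polymap u -> definable S [set x | A (u x)].
Proof.
move=> SA pu.
have SC : definable S [set z : 'rV[R]_(m + n) | A (lsubmx z) /\
    forall j, lsubmx z 0 j - u (rsubmx z) 0 j = 0].
  apply: definable_and.
    apply: definable_eq (definableX SA (definableT S n)).
    apply/seteqP; split=> [_ [a Aa [b _ <-]]|z Az] /=; first by rewrite row_mxKl.
    by exists (lsubmx z) => //; exists (rsubmx z) => //; rewrite hsubmxK.
  apply: definable_zero => j; apply: polyfunB.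
    exact/polymap_lsub/polymap_id.
  exact: (@polyfun_rsub _ m n (fun x => u x 0 j) (pu j)).
apply: definable_eq
  (@definable_ex m n (fun y x => A y /\ forall j, y 0 j - u x 0 j = 0) SC).
apply/seteqP; split=> x /=.
  move=> [y [Ay yu]]; suff -> : u x = y by [].
  by apply/rowP => j; apply/esym/eqP; rewrite -subr_eq0 yu.
by move=> Au; exists (u x); split=> // j; rewrite subrr.
Qed.

(** Positive elements have square roots, so [x] is positive iff [x * y ^+ 2 = 1] has a solution [y]:
    positivity is a projection of an algebraic set. *)
Lemma definable_pos : definable S [set x : 'rV[R]_1 | 0 < x 0 0].
Proof.
have SC : definable S [set z : 'rV[R]_(1 + 1) | forall i : 'I_1,
    rsubmx z 0 0 * (lsubmx z 0 0) ^+ 2 - 1 = 0].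
  apply: definable_zero => _; apply: polyfunB; last exact: polyfun_cst.
  apply: polyfunM; last apply: polyfunX2.
    exact/polymap_rsub/polymap_id.
  exact/polymap_lsub/polymap_id.
apply: definable_eq (@definable_ex 1 1
  (fun y x => forall i : 'I_1, x 0 0 * (y 0 0) ^+ 2 - 1 = 0) SC).
apply/seteqP; split=> x /=.
  move=> [y /(_ 0)/eqP]; rewrite subr_eq0 => /eqP xy.
  rewrite ltNge; apply/negP => le0.
  by have := mulr_le0_ge0 le0 (sqr_ge0 (y 0 0)); rewrite xy ler10.
move=> x0; exists (const_mx (Num.sqrt (x 0 0))^-1) => _.
by rewrite mxE exprVn sqr_sqrtr ?ltW// mulfV ?subrr// gt_eqF.
Qed.

Lemma definable_lt n (u v : 'rV[R]_n -> R) :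
  polyfun u -> polyfun v -> definable S [set x | u x < v x].
Proof.
move=> pu pv.
apply: definable_eq (definable_preimage definable_pos
  (polymap_const (polyfunB pv pu))).
by apply/seteqP; split=> x /=; rewrite mxE subr_gt0.
Qed.

Lemma definable_le n (u v : 'rV[R]_n -> R) :
  polyfun u -> polyfun v -> definable S [set x | u x <= v x].
Proof.
move=> pu pv; apply: definable_eq (definable_not (definable_lt pv pu)).
by apply/seteqP; split=> x /=; rewrite leNgt => /negP.
Qed.

Lemma definable_row_in m n (A : set 'rV[R]_(m + n)) k u v :
  definable S A -> polymap u -> polymap v ->
  definable S [set x : 'rV[R]_k | A (row_mx (u x) (v x))].
Proof.
by move=> SA pu pv; apply: definable_preimage => //; exact: polymap_row.
Qed.

End Definability.

(** * Tameness on the line *)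

Section Tameness.
Context {R : rcfType}.

Lemma near0_point_or_open_interval (F : set R) : point_or_open_interval F ->
  (\forall t \near 0^'+, F t) \/ (\forall t \near 0^'+, ~ F t).
Proof.
have gt0 (a : R) : 0 < a -> \forall t \near 0^'+, t < a.
  by move=> a0; exact: nbhs_right_lt.
(* Every endpoint is eventually on one side of [t]; as [t] tends to 0 from the right, [a = 0] falls
   on the left. *)
have nlt (a : R) : (\forall t \near 0^'+, a < t) \/ (\forall t \near 0^'+, t < a).
  have [a0|a0] := leP a 0; last by right; exact: gt0.
  left; near=> t; apply: le_lt_trans a0 _; near: t; exact: nbhs_right_gt.
case=> [a|a b|a|b|].
- right; case: (nlt a); apply: filterS => t /= ta tE;
  by move: ta; rewrite tE ltxx.
- case: (nlt a) => [ta|ta].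
    case: (nlt b) => [tb|tb].
      right; apply: filterS tb => t /ltW bt; rewrite /= in_itv /= => /andP[_].
      by rewrite ltNge bt.
    by left; apply: filterS2 ta tb => t; rewrite /= in_itv /= => -> ->.
  right; apply: filterS ta => t /ltW ta; rewrite /= in_itv /= => /andP[].
  by rewrite ltNge ta.
- case: (nlt a) => ta; [left|right]; apply: filterS ta => t.
    by rewrite /= in_itv /= => ->.
  by move=> /ltW ta; rewrite /= in_itv /= andbT ltNge ta.
- case: (nlt b) => ta; [right|left]; apply: filterS ta => t.
    by move=> /ltW ta; rewrite /= in_itv /= ltNge ta.
  by rewrite /= in_itv /= => ->.
- by left; near=> t; rewrite /= in_itv.
Unshelve. all: by end_near. Qed.

(** A real closed field need not be complete, so the supremum is a relation, and its existence is
    proved for bounded nonempty definable sets. *)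
Definition is_sup (P : R -> Prop) (s : R) :=
  (forall x, P x -> x <= s) /\ (forall u, (forall x, P x -> x <= u) -> s <= u).

Lemma is_sup_point_or_open_interval (F : set R) b : point_or_open_interval F ->
  (exists x, F x) -> (forall x, F x -> x <= b) -> exists s, is_sup F s.
Proof.
(* If [u < c], the midpoint of [c] and the larger of [a] and [u] lies in the interval and exceeds
   [u]. *)
have mid (a c u : R) : a < c -> (forall x, a < x < c -> x <= u) -> c <= u.
  move=> ac Fu; rewrite leNgt; apply/negP => uc.
  have [au|ua] := ltP a u.
    have /Fu : a < (u + c) / 2 < c by apply/andP; split; lra.
    by lra.
  have /Fu : a < (a + c) / 2 < c by apply/andP; split; lra.
  by lra.
case=> [a|a c|a|c|] [x Fx] Fb.
- exists a; split=> [_ ->//|u]; exact.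
- move: Fx; rewrite /= in_itv /= => /andP[ax xc].
  exists c; split=> [y|u Fu]; first by rewrite /= in_itv /= => /andP[_ /ltW].
  apply: (mid a); first exact: lt_trans xc.
  by move=> y ay; apply: Fu; rewrite /= in_itv.
- move: Fx; rewrite /= in_itv /= andbT => ax.
  have xb : x <= b by apply: Fb; rewrite /= in_itv /= ax.
  have : b + 1 <= b by apply: Fb; rewrite /= in_itv /= andbT; lra.
  by lra.
- exists c; split=> [y|u Fu]; first by rewrite /= in_itv /= => /ltW.
  apply: (mid (c - 1)); first by lra.
  by move=> y /andP[_ yc]; apply: Fu; rewrite /= in_itv.
- have : b + 1 <= b by apply: Fb; rewrite /= in_itv.
  by lra.
Qed.

(** The largest of the suprema of the nonempty pieces works. Empty pieces get the dummy value 0 and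
    are kept out of the maximum by [Q]. *)
Lemma is_sup_fin_bigcup k (F : 'I_k -> set R) b :
  (forall i, point_or_open_interval (F i)) ->
  (exists x, (\bigcup_i F i) x) -> (forall x, (\bigcup_i F i) x -> x <= b) ->
  exists s, is_sup (\bigcup_i F i) s.
Proof.
move=> Fi [x0 [i0 _ Fx0]] Fb.
have /choice[s sP] i : exists s, (exists x, F i x) -> is_sup (F i) s.
  have [Fi0|Fi0] := pselect (exists x, F i x); last by exists 0.
  have [|s sF] := is_sup_point_or_open_interval (Fi i) Fi0 (b := b).
    by move=> x Fx; apply: Fb; exists i.
  by exists s.
pose Q i := `[< exists x, F i x >].
have Qi0 : Q i0 by apply/asboolP; exists x0.
case: (@arg_maxP _ _ _ i0 Q s Qi0) => i /asboolP Fix smax.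
exists (s i); split=> [x [j _ Fx]|u Fu].
  have Fj : exists y, F j y by exists x.
  have [+ _] := sP _ Fj => /(_ _ Fx) /le_trans; apply.
  by apply: smax; exact/asboolP.
have [_] := sP _ Fix; apply=> x Fx.
by apply: Fu; exists i.
Qed.

Context (S : omin R).

Lemma definable_tame1 (P : R -> Prop) :
  definable S [set x : 'rV_1 | P (x 0 0)] ->
  exists k (F : 'I_k -> set R), (forall i, point_or_open_interval (F i)) /\
    P = \bigcup_i F i.
Proof.
move=> /definable_tame[k [F [Fi PE]]]; exists k, F; split=> //; rewrite -PE.
apply/seteqP; split=> [x Px|_ [x Px <-]//].
by exists (const_mx x) => /=; rewrite mxE.
Qed.

(** Each of the finitely many pieces eventually contains [t] or eventually avoids it. This dichotomy
    later yields strict inequalities between germs. *)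
Lemma definable_near0 (P : R -> Prop) :
  definable S [set x : 'rV_1 | P (x 0 0)] ->
  (\forall t \near 0^'+, P t) \/ (\forall t \near 0^'+, ~ P t).
Proof.
move=> /definable_tame1[k [F [Fi ->]]].
have [[i Fi0]|nF] := pselect (exists i, \forall t \near 0^'+, F i t).
  by left; apply: filterS Fi0 => t Ft; exists i.
right.
have : \forall t \near (0:R)^'+, forall i, ~ F i t.
  apply: filter_forall => i; case: (near0_point_or_open_interval (Fi i)) => // ?.
  by case: nF; exists i.
by apply: filterS => t nFt [i _]; exact: nFt.
Qed.

Lemma definable_is_sup (P : R -> Prop) a b :
  definable S [set x : 'rV_1 | P (x 0 0)] ->
  P a -> (forall x, P x -> x <= b) -> exists s, is_sup P s.
Proof.
move=> /definable_tame1[k [F [Fi ->]]] Pa.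
by apply: is_sup_fin_bigcup => //; exists a.
Qed.

End Tameness.

(** * Euclidean norm *)

Section EuclideanNorm.
Context {R : rcfType}.

Let sqsum_ge0 n (x : 'rV[R]_n) : 0 <= \sum_i x 0 i ^+ 2.
Proof. by apply: sumr_ge0 => i _; exact: sqr_ge0. Qed.

Lemma enorm_ge0 n (x : 'rV[R]_n) : 0 <= enorm x.
Proof. exact: sqrtr_ge0. Qed.

Lemma sqr_enorm n (x : 'rV[R]_n) : enorm x ^+ 2 = \sum_i x 0 i ^+ 2.
Proof. by rewrite sqr_sqrtr. Qed.

Lemma enorm0 n : enorm (0 : 'rV[R]_n) = 0.
Proof. by rewrite /enorm big1 ?sqrtr0// => i _; rewrite mxE expr0n. Qed.

Lemma enormN n (x : 'rV[R]_n) : enorm (- x) = enorm x.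
Proof.
by rewrite /enorm; congr Num.sqrt; apply: eq_bigr => i _; rewrite mxE sqrrN.
Qed.

Lemma enormB n (x y : 'rV[R]_n) : enorm (x - y) = enorm (y - x).
Proof. by rewrite -enormN opprB. Qed.

Lemma sum_sqrB n (x y : 'rV[R]_n) :
  \sum_i (x 0 i - y 0 i) ^+ 2 = \sum_i (x - y) 0 i ^+ 2.
Proof. by apply: eq_bigr => i _; rewrite !mxE. Qed.

(** Squaring removes the root, so that norm conditions become polynomial inequalities and hence
    definable. *)
Lemma enorm_lt n (x : 'rV[R]_n) (a : R) :
  (enorm x < a) = (0 < a) && (\sum_i x 0 i ^+ 2 < a ^+ 2).
Proof.
have [a0|a0] /= := ltP 0 a.
  by rewrite -sqr_enorm ltr_sqr ?nnegrE ?enorm_ge0 ?ltW.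
by apply/negbTE; rewrite -leNgt (le_trans a0)// enorm_ge0.
Qed.

Lemma enorm_le n (x : 'rV[R]_n) (a : R) :
  (enorm x <= a) = (0 <= a) && (\sum_i x 0 i ^+ 2 <= a ^+ 2).
Proof.
have [a0|a0] /= := leP 0 a.
  by rewrite -sqr_enorm ler_sqr ?nnegrE ?enorm_ge0.
by apply/negbTE; rewrite -ltNge (lt_le_trans a0)// enorm_ge0.
Qed.

(** Cauchy-Schwarz, from the nonnegativity of the squared norm of [V x - W y], which equals
    [V * (U * V - W ^+ 2)]. *)
Lemma sum_mul_le_enorm n (x y : 'rV[R]_n) :
  \sum_i x 0 i * y 0 i <= enorm x * enorm y.
Proof.
set W := \sum_i _; pose U := \sum_i x 0 i ^+ 2; pose V := \sum_i y 0 i ^+ 2.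
have U0 : 0 <= U by exact: sqsum_ge0.
have V0 : 0 <= V by exact: sqsum_ge0.
have WUV : W ^+ 2 <= U * V.
  have : 0 <= \sum_i (V * x 0 i - W * y 0 i) ^+ 2.
    by apply: sumr_ge0 => i _; exact: sqr_ge0.
  have -> : \sum_i (V * x 0 i - W * y 0 i) ^+ 2 = V * (U * V - W ^+ 2).
    rewrite (eq_bigr (fun i => V ^+ 2 * x 0 i ^+ 2 - 2 * V * W * (x 0 i * y 0 i)
      + W ^+ 2 * y 0 i ^+ 2)); last by move=> i _; ring.
    by rewrite big_split sumrB/= -!mulr_sumr -/U -/V -/W; ring.
  (* A positive factor [V] can be cancelled; if [V = 0] then [y = 0] and so [W = 0]. *)
  have [V00 _|Vn0] := eqVneq V 0; last first.
    by rewrite pmulr_rge0 ?subr_ge0// lt_def Vn0.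
  rewrite /W big1 ?V00 ?mulr0 ?expr0n// => i _.
  suff /eqP : y 0 i ^+ 2 = 0 by rewrite sqrf_eq0 => /eqP ->; rewrite mulr0.
  by apply: (psumr_eq0P _ V00) => // j _; exact: sqr_ge0.
rewrite -sqrtrM// (le_trans (ler_norm W))// -sqrtr_sqr ler_wsqrtr//.
Qed.

Lemma ler_enormD n (x y : 'rV[R]_n) : enorm (x + y) <= enorm x + enorm y.
Proof.
rewrite enorm_le addr_ge0 ?enorm_ge0//= sqrrD !sqr_enorm.
under eq_bigr do rewrite mxE sqrrD.
rewrite !big_split/= lerD2r lerD2l.
by rewrite mulr2n lerD// sum_mul_le_enorm.
Qed.

Lemma enorm_coord n (x : 'rV[R]_n) i j : `|x i j| <= enorm x.
Proof.
rewrite (ord1 i) -sqrtr_sqr ler_wsqrtr// (bigD1 j)//= lerDl.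
by apply: sumr_ge0 => k _; exact: sqr_ge0.
Qed.

Lemma enorm_le_coord n (x : 'rV[R]_n) d :
  (forall j, `|x 0 j| <= d) -> 0 <= d -> enorm x <= n%:R * d.
Proof.
move=> xd d0; rewrite enorm_le mulr_ge0//=.
have -> : (n%:R * d) ^+ 2 = n%:R * (n%:R * d ^+ 2) by ring.
apply: (@le_trans _ _ (n%:R * d ^+ 2)).
  rewrite mulr_natl -[X in _ *+ X]card_ord -sumr_const; apply: ler_sum => i _.
  by rewrite -real_normK ?num_real// ler_sqr ?nnegrE.
by case: n x xd => [|n] x xd; rewrite ?mul0r// ler_peMl ?mulr_ge0 ?sqr_ge0 ?ler1n.
Qed.

Lemma enorm1 (a : R) : enorm (const_mx a : 'rV_1) = `|a|.
Proof. by rewrite /enorm big_ord1 mxE sqrtr_sqr. Qed.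

(** The topology on matrices comes from the maximum norm; comparing coordinates with [enorm] shows
    that Euclidean balls give the same neighbourhoods. *)
Lemma nbhs_enorm n (x : 'rV[R]_n) (U : set 'rV[R]_n) :
  nbhs x U <-> exists2 d, 0 < d & forall y, enorm (y - x) < d -> U y.
Proof.
split=> [/nbhs_ballP[d /= d0 dU]|[d d0 dU]].
  exists d => // y yx; apply: dU; split=> // i j; rewrite /ball /= distrC.
  by apply: le_lt_trans yx; have := enorm_coord (y - x) i j; rewrite !mxE.
apply/nbhs_ballP; have n0 : 0 < n%:R + 1 :> R by rewrite ltr_wpDl.
(* Dividing by [n + 1] instead of [n] covers dimension 0 and makes the final inequality strict. *)
exists (d / (n%:R + 1)) => [|y yx]; first by rewrite /= divr_gt0.
apply: dU; apply: (@le_lt_trans _ _ (n%:R * (d / (n%:R + 1)))).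
  apply: enorm_le_coord => [j|]; last by rewrite divr_ge0 ?ltW.
  by have := yx.2 0 j; rewrite /ball /= distrC !mxE => /ltW.
by rewrite mulrA ltr_pdivrMr// mulrC ltr_pM2l// ltrDl.
Qed.

Lemma cvg_enormP T n (F : set_system T) (FF : Filter F)
    (u : T -> 'rV[R]_n) (l : 'rV[R]_n) :
  (u x @[x --> F] --> l) <->
  forall e, 0 < e -> \forall x \near F, enorm (u x - l) < e.
Proof.
split=> [ul e e0|ul U /nbhs_enorm[d d0 dU]].
  apply: (ul [set y | enorm (y - l) < e]).
  by apply/nbhs_enorm; exists e.
by have := ul _ d0; apply: filterS => x; exact: dU.
Qed.

End EuclideanNorm.

(** * Modulus of continuity along a curve *)

Section Curves.
Context {R : rcfType} (S : omin R).

Lemma curve_graphE n e (c : R -> 'rV[R]_n) t x :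
  [set row_mx s%:M (c s) | s in `]0, e[] (row_mx (t : 'rV[R]_1) x) <->
  0 < t 0 0 < e /\ x = c (t 0 0).
Proof.
split=> [[s]|[te ->]].
  rewrite /= in_itv /= => se /(@eq_row_mx _ 1 1 n)[<- <-].
  by rewrite mxE mulr1n.
exists (t 0 0); first by rewrite /= in_itv.
by congr row_mx; apply/rowP => j; rewrite !mxE !ord1 mulr1n.
Qed.

Lemma map_graphE n m (X : set 'rV[R]_n) (f : 'rV[R]_n -> 'rV[R]_m) x y :
  [set row_mx x (f x) | x in X] (row_mx x y) <-> X x /\ y = f x.
Proof. by split=> [[z Xz /eq_row_mx[<- <-]]|[Xx ->]]//; exists x. Qed.

(** Allows several germs to be put on one common interval. *)
Lemma cont_definable_on_sub n (c : R -> 'rV[R]_n) e e' :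
  cont_definable_on S e c -> e' <= e -> cont_definable_on S e' c.
Proof.
move=> [cc dc] e'e; split=> [t|].
  rewrite in_itv /= => /andP[t0 te]; apply: cc; rewrite in_itv /= t0.
  exact: lt_le_trans te e'e.
have SD : definable S [set x : 'rV[R]_(1 + n) | x 0 (lshift n 0) < e' /\
    [set row_mx t%:M (c t) | t in `]0, e[] x].
  apply: definable_and dc; apply: definable_lt; last exact: polyfun_cst.
  exact: polyfun_coord.
apply: definable_eq SD; apply/seteqP; split=> x /=.
  move=> [xe' [t]]; rewrite in_itv /= => /andP[t0 te] xE; exists t => //.
  by move: xe'; rewrite -xE row_mxEl mxE mulr1n in_itv /= t0.
move=> [t]; rewrite in_itv /= => /andP[t0 te'] <-.
split; first by rewrite row_mxEl mxE mulr1n.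
by exists t => //; rewrite in_itv /= t0 (lt_le_trans te').
Qed.

End Curves.

Ltac polynomiality := repeat first
  [ exact: polymap_id | exact: polyfun_cst
  | apply: polymap_lsub | apply: polymap_rsub | apply: polymap_row
  | apply: polymap_entry | apply: polyfun_sum => ?
  | apply: polyfunB | apply: polyfunX2 | apply: polyfunM ].

(** * The modulus, and the definability and continuity of its supremum *)

Section Modulus.
Context {R : rcfType} (S : omin R) (n m : nat).
Context (X : set 'rV[R]_n) (f : 'rV[R]_n -> 'rV[R]_m).
Context (e : R) (g : R -> 'rV[R]_n) (c : R -> 'rV[R]_m) (r : R -> 'rV[R]_1).

(* The slack [- rho] in the values makes [modulus] stable under moving [t] at the
   cost of the displacement of [g], [c] and [r], so that its supremum over [rho]
   is continuous in [t]. *)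
Definition modulus t rho := [/\ 0 < rho, rho <= 1 &
  forall b, X b -> enorm (b - g t) < rho ->
    enorm (f b - c t) <= r t 0 0 - rho].

Context (fcont : {within X, continuous f})
  (fdef : definable S [set row_mx x (f x) | x in X])
  (gP : cont_definable_on S e g) (cP : cont_definable_on S e c)
  (rP : cont_definable_on S e r)
  (gX : forall t : R, 0 < t < e -> X (g t))
  (fgr : forall t : R, 0 < t < e -> enorm (f (g t) - c t) < r t 0 0).

(** Two triangle inequalities: the displacement of [g] is absorbed by the smaller radius, those of
    [c] and [r] by the smaller slack. *)
Lemma modulus_shift t s rho eta :
  enorm (g s - g t) + enorm (c s - c t) + `|r s 0 0 - r t 0 0| <= eta ->
  eta < rho -> modulus t rho -> modulus s (rho - eta).
Proof.
move=> st etarho [rho0 rho1 trho].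
have gst := enorm_ge0 (g s - g t); have cst := enorm_ge0 (c s - c t).
have rst := ler_norm (r t 0 0 - r s 0 0); rewrite distrC in rst.
have rst0 := normr_ge0 (r s 0 0 - r t 0 0).
split; [by lra|by lra|move=> b Xb bs].
have bt : enorm (b - g t) < rho.
  have := ler_enormD (b - g s) (g s - g t); rewrite addrA subrK; lra.
have := trho _ Xb bt.
have := ler_enormD (f b - c t) (c t - c s); rewrite addrA subrK.
by rewrite (enormB (c t)); lra.
Qed.

Lemma modulus_exists t : 0 < t < e -> exists rho, modulus t rho.
Proof.
move=> te; have := fgr te; set k := enorm _ => kr.
have kr2 : 0 < (r t 0 0 - k) / 2 by lra.
have /(subspace_continuousP X f).1/(_ _ (gX te))/cvg_enormP/(_ _ kr2) := fcont.
rewrite /within /= near_withinE => /nbhs_enorm[d d0 dX].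
(* Half of the gap [r - k] bounds the variation of [f] on the ball of radius [d]; the other half
   pays for the slack [rho]. *)
exists (Num.min d (Num.min 1 ((r t 0 0 - k) / 2))).
split; first by rewrite !lt_min d0 ltr01.
  by rewrite !ge_min lexx orbT.
move=> b Xb; rewrite lt_min => /andP[/dX/(_ Xb) fb _].
have := ler_enormD (f b - f (g t)) (f (g t) - c t); rewrite addrA subrK -/k.
have : Num.min d (Num.min 1 ((r t 0 0 - k) / 2)) <= (r t 0 0 - k) / 2.
  by rewrite !ge_min lexx !orbT.
by lra.
Qed.

Lemma definable_modulus : definable S [set w : 'rV[R]_(1 + 1) |
  0 < rsubmx w 0 0 < e /\ modulus (rsubmx w 0 0) (lsubmx w 0 0)].
Proof.
pose G := [set row_mx s%:M (g s) | s in `]0, e[].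
pose C := [set row_mx s%:M (c s) | s in `]0, e[].
pose Q := [set row_mx s%:M (r s) | s in `]0, e[].
pose F := [set row_mx x (f x) | x in X].
have [_ SG] := gP; have [_ SC] := cP; have [_ SQ] := rP.
(* The same condition as a first-order formula: [x], [y], [z] and [a] name the values of [g], [c],
   [r] and [f] through their graphs, and norms are squared. The left coordinate is [rho], the right
   one is [t]. *)
have SW : definable S [set w : 'rV[R]_(1 + 1) |
    0 < lsubmx w 0 0 /\ lsubmx w 0 0 <= 1 /\
    exists x : 'rV[R]_n, exists y : 'rV[R]_m, exists z : 'rV[R]_1,
      G (row_mx (rsubmx w) x) /\ C (row_mx (rsubmx w) y) /\
      Q (row_mx (rsubmx w) z) /\ forall b, forall a, F (row_mx b a) ->
      0 < lsubmx w 0 0 /\ \sum_i (b 0 i - x 0 i) ^+ 2 < lsubmx w 0 0 ^+ 2 ->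
      0 <= z 0 0 - lsubmx w 0 0 /\
      \sum_i (a 0 i - y 0 i) ^+ 2 <= (z 0 0 - lsubmx w 0 0) ^+ 2].
  apply: definable_and; first by apply: definable_lt; polynomiality.
  apply: definable_and; first by apply: definable_le; polynomiality.
  apply: definable_ex; apply: definable_ex; apply: definable_ex.
  apply: definable_and; first by apply: definable_row_in => //; polynomiality.
  apply: definable_and; first by apply: definable_row_in => //; polynomiality.
  apply: definable_and; first by apply: definable_row_in => //; polynomiality.
  apply: definable_all; apply: definable_all.
  apply: definable_imp; first by apply: definable_row_in => //; polynomiality.
  apply: definable_imp.
    by apply: definable_and; apply: definable_lt; polynomiality.
  by apply: definable_and; apply: definable_le; polynomiality.
apply: definable_eq SW; apply/seteqP; split=> w /=.
  move=> [rho0 [rho1 [x [y [z]]]]].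
  move=> [/curve_graphE[te ->]] [/curve_graphE[_ ->]] [/curve_graphE[_ ->]] H.
  split=> //; split=> // b Xb; rewrite enorm_lt enorm_le => /andP[_ bx].
  have Fb : F (row_mx b (f b)) by exact/map_graphE.
  by have [] := H _ _ Fb; rewrite !sum_sqrB => // -> ->.
move=> [te [rho0 rho1 H]]; split=> //; split=> //.
exists (g (rsubmx w 0 0)), (c (rsubmx w 0 0)), (r (rsubmx w 0 0)).
do 3 (split; first exact/curve_graphE).
move=> b a /map_graphE[Xb ->] [_]; rewrite !sum_sqrB => bx.
have := H b Xb; rewrite enorm_lt enorm_le rho0 => /(_ bx) /andP[//].
Qed.

Lemma definable_modulus_at t : 0 < t < e ->
  definable S [set x : 'rV[R]_1 | modulus t (x 0 0)].
Proof.
move=> te; have SW := definable_preimage definable_modulus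
  (polymap_row (@polymap_id R 1) (polymap_const (polyfun_cst 1 t))).
apply: definable_eq SW; apply/seteqP.
by split=> x /=; rewrite row_mxKl row_mxKr mxE; [case|].
Qed.

(** The clause [rho <= 1] of [modulus] supplies the upper bound. Outside the interval the choice
    takes the dummy value 0. *)
Lemma modulus_sup_exists : exists sigma : R -> R,
  forall t, 0 < t < e -> is_sup (modulus t) (sigma t).
Proof.
suff /choice[sigma sP] : forall t, exists s, 0 < t < e -> is_sup (modulus t) s.
  by exists sigma.
move=> t; have [te|_] := boolP (0 < t < e); last by exists 0.
have [rho trho] := modulus_exists te.
have [|s sP] := definable_is_sup (definable_modulus_at te) trho (b := 1).
  by move=> x [].
by exists s.
Qed.

Context (sigma : R -> R)
  (sigmaP : forall t : R, 0 < t < e -> is_sup (modulus t) (sigma t)).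

Lemma modulus_sup_gt0 t : 0 < t < e -> 0 < sigma t.
Proof.
move=> te; have [rho trho] := modulus_exists te; have [rho0 _ _] := trho.
by have [/(_ _ trho) rs _] := sigmaP te; apply: lt_le_trans rs.
Qed.

Lemma modulus_sup_shift t s eta : 0 < t < e -> 0 < s < e ->
  enorm (g s - g t) + enorm (c s - c t) + `|r s 0 0 - r t 0 0| <= eta ->
  sigma t <= sigma s + eta.
Proof.
move=> te se st; have [_] := sigmaP te; apply=> rho trho.
have s0 := modulus_sup_gt0 se.
(* When [rho <= eta] no shifted radius is left, but positivity of [sigma s] already gives the
   bound. *)
have [rhoeta|etarho] := leP rho eta; first by lra.
have /(sigmaP se).1 := modulus_shift st etarho trho.
by rewrite lerBlDr.
Qed.

(** The graph is first-order: [y] is the value at [t] iff [2 * y] is the least upper bound of the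
    radii admissible at [t]. *)
Lemma definable_half_modulus_sup :
  definable S [set row_mx t%:M (const_mx (sigma t / 2) : 'rV_1) | t in `]0, e[].
Proof.
pose M := [set w : 'rV[R]_(1 + 1) |
  0 < rsubmx w 0 0 < e /\ modulus (rsubmx w 0 0) (lsubmx w 0 0)].
have SM : definable S M by exact: definable_modulus.
have SD : definable S [set w : 'rV[R]_(1 + 1) |
    0 < lsubmx w 0 0 /\ lsubmx w 0 0 < e /\
    (forall x : 'rV[R]_1, M (row_mx x (lsubmx w)) ->
       x 0 0 <= 2 * rsubmx w 0 0) /\
    forall u : 'rV[R]_1,
      (forall x : 'rV[R]_1, M (row_mx x (lsubmx w)) -> x 0 0 <= u 0 0) ->
       2 * rsubmx w 0 0 <= u 0 0].
  apply: definable_and; first by apply: definable_lt; polynomiality.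
  apply: definable_and; first by apply: definable_lt; polynomiality.
  apply: definable_and.
    apply: definable_all; apply: definable_imp;
    last by apply: definable_le; polynomiality.
    by apply: definable_row_in => //; polynomiality.
  apply: definable_all; apply: definable_imp;
    last by apply: definable_le; polynomiality.
  apply: definable_all; apply: definable_imp;
    last by apply: definable_le; polynomiality.
  by apply: definable_row_in => //; polynomiality.
apply: definable_eq SD.
have ME (x : R) (y : 'rV[R]_1) : 0 < y 0 0 < e ->
    M (row_mx (const_mx x) y) <-> modulus (y 0 0) x.
  by move=> ye; rewrite /M /= row_mxKl row_mxKr mxE; split=> [[]|].
have constE (x : 'rV[R]_1) : x = const_mx (x 0 0).
  by apply/rowP => j; rewrite mxE !ord1.
apply/seteqP; split=> w /=.
  move=> [t0 [te [ub lub]]].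
  have t0e : 0 < lsubmx w 0 0 < e by rewrite t0.
  have [ub' lub'] := sigmaP t0e.
  exists (lsubmx w 0 0); first by rewrite in_itv.
  have -> : sigma (lsubmx w 0 0) = 2 * rsubmx w 0 0.
    apply/eqP; rewrite eq_le; apply/andP; split.
      by apply: lub' => x /(ME _ _ t0e)/ub; rewrite mxE.
    have := lub (const_mx (sigma (lsubmx w 0 0))).
    have -> a : (const_mx a : 'rV[R]_1) 0 0 = a by rewrite mxE.
    apply=> x.
    by rewrite {1}(constE x) => /(ME _ _ t0e)/ub'.
  rewrite -[RHS](@hsubmxK _ 1 1 1); congr row_mx.
    by apply/rowP => j; rewrite !mxE !ord1 mulr1n.
  by apply/rowP => j; rewrite mxE mulrC mulKf ?pnatr_eq0// (ord1 j).
move=> [t]; rewrite in_itv /= => te <-.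
rewrite row_mxKl row_mxKr !mxE mulr1n mulrC divfK ?pnatr_eq0//.
have [ub lub] := sigmaP te; have [-> ->] := andP te.
have te' : 0 < (t%:M : 'rV[R]_1) 0 0 < e by rewrite mxE mulr1n.
do 2 split=> //.
have tE : (t%:M : 'rV[R]_1) 0 0 = t by rewrite mxE mulr1n.
split=> [x|u H].
  by rewrite (constE x) => /(ME _ _ te'); rewrite tE mxE => /ub.
apply: lub => x tx.
have /H : M (row_mx (const_mx x) t%:M) by apply/ME; rewrite ?tE.
by rewrite mxE.
Qed.

Lemma continuous_half_modulus_sup :
  {in `]0, e[, continuous (fun t => const_mx (sigma t / 2) : 'rV[R]_1)}.
Proof.
move=> t; rewrite in_itv /= => te; apply/cvg_enormP => eta eta0.
have [[gc _] [cc _]] := (gP, cP); have [rc _] := rP.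
have te' : t \in `]0, e[ by rewrite in_itv.
(* One third for each of the displacements of [g], [c] and [r]. The shift in both directions bounds
   the change of [sigma] by [eta], and halving makes it strict. *)
have eta3 : 0 < eta / 3 by lra.
have /cvg_enormP/(_ _ eta3) gt := gc t te'.
have /cvg_enormP/(_ _ eta3) ct := cc t te'.
have /cvg_enormP/(_ _ eta3) rt := rc t te'.
near=> s.
have se : 0 < s < e.
  have : s \in `]0, e[ by near: s; exact: near_in_itvoo.
  by rewrite in_itv.
have gs : enorm (g s - g t) < eta / 3 by near: s.
have cs : enorm (c s - c t) < eta / 3 by near: s.
have rs : `|r s 0 0 - r t 0 0| < eta / 3.
  have rs : enorm (r s - r t) < eta / 3 by near: s.
  by apply: le_lt_trans rs; have := enorm_coord (r s - r t) 0 0; rewrite !mxE.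
have ts := @modulus_sup_shift t s eta te se.
have st := @modulus_sup_shift s t eta se te.
rewrite (enormB (g t)) (enormB (c t)) distrC in st.
have -> : (const_mx (sigma s / 2) - const_mx (sigma t / 2) : 'rV[R]_1) =
    const_mx (sigma s / 2 - sigma t / 2).
  by apply/rowP => j; rewrite !mxE.
rewrite enorm1 ltr_norml; have := ts _; have := st _; lra.
Unshelve. all: by end_near. Qed.

End Modulus.

Lemma exists_radius (R : rcfType) (S : omin R) n m
    (X : set 'rV[R]_n) (Y : set 'rV[R]_m) f e g (c : R -> 'rV[R]_m)
    (r : R -> 'rV[R]_1) :
  cont_definable_map S X Y f -> cont_definable_on S e g ->
  cont_definable_on S e c -> cont_definable_on S e r ->
  (forall t, 0 < t < e -> X (g t)) ->
  (forall t, 0 < t < e -> enorm (f (g t) - c t) < r t 0 0) ->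
  exists2 d : R -> 'rV[R]_1, cont_definable_on S e d &
    forall t, 0 < t < e -> 0 < d t 0 0 /\
      forall b, X b -> enorm (b - g t) <= d t 0 0 ->
        enorm (f b - c t) < r t 0 0.
Proof.
move=> [_ fc fd] gP cP rP gX fgr.
have [sigma sigmaP] := modulus_sup_exists fc fd gP cP rP gX fgr.
exists (fun t => const_mx (sigma t / 2)).
  split; first exact: (continuous_half_modulus_sup fc gP cP rP gX fgr sigmaP).
  exact: (definable_half_modulus_sup fd gP cP rP sigmaP).
move=> t te; have s0 := modulus_sup_gt0 fc gX fgr sigmaP te.
rewrite mxE; split=> [|b Xb bs]; first by lra.
rewrite ltNge; apply/negP => rb.
(* An admissible [rho] above [sigma t / 2] would force [f b] strictly inside the ball. So a bad [b]
   makes [sigma t / 2] an upper bound, against [sigma t > 0]. *)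
have : sigma t <= sigma t / 2.
  apply: (sigmaP _ te).2 => rho [rho0 _ trho].
  rewrite leNgt; apply/negP => srho.
  have := trho b Xb (le_lt_trans bs srho); lra.
by lra.
Qed.

(** * Germs *)

Section Germs.
Context {R : rcfType} (S : omin R).

Lemma germ_ball_open n (c : germ S n) (r : germ S 1) :
  germ_lt (fun=> 0) (fun t => germ_fun r t 0 0) -> open (germ_ball c r).
Proof.
move=> r0; exists [set (germ_ball c r)]; last by rewrite bigcup_set1.
move=> _ ->; exists [fset (germ_ball c r)]%fset; last first.
  by rewrite set_fset1 bigcap_set1.
by move=> B; rewrite in_fset1 => /eqP ->; rewrite inE; exists c, r.
Qed.

(** A neighbourhood of [y] contains a finite intersection of subbasic balls through [y], and filters
    are closed under finite intersections. *)
Lemma cvg_germ n (F : set_system (germ S n)) (y : germ S n) : Filter F ->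
  (forall (c : germ S n) (r : germ S 1), germ_ball c r y -> F (germ_ball c r)) ->
  F --> y.
Proof.
move=> FF Fball A; rewrite /= nbhsE => -[_ [[B sB <-] [C BC Cy] sUBA]].
rewrite nbhs_filterE; apply: filterS sUBA _; apply: (@filterS _ _ _ C).
  by move=> z Cz; exists C.
have /sB [D sD IDeC] := BC; rewrite -IDeC; apply: filter_bigI => E DE.
have /sD := DE; rewrite inE => -[c [r [_ EE]]]; rewrite EE.
by apply: Fball; rewrite -EE; move: Cy; rewrite -IDeC => /(_ _ DE).
Qed.

(** The strict inequality is a definable condition on [t], so it eventually holds or eventually
    fails. If it failed, the eventual weak inequality would become an equality of germs, which
    [germ_lt] excludes. *)
Lemma germ_ball_near n (c y : germ S n) (r : germ S 1) : germ_ball c r y ->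
  \forall t \near 0^'+, enorm (germ_fun y t - germ_fun c t) < germ_fun r t 0 0.
Proof.
move=> [yr yrE].
have [e1 e10 [_ Sy]] := curveP (repr y); have [e2 e20 [_ Sc]] := curveP (repr c).
have [e3 e30 [_ Sr]] := curveP (repr r).
set Gy := [set _ | _ in _] in Sy; set Gc := [set _ | _ in _] in Sc.
set Gr := [set _ | _ in _] in Sr.
have SP : definable S [set x : 'rV[R]_1 | exists a : 'rV[R]_n,
    exists b : 'rV[R]_n, exists z : 'rV[R]_1,
    Gy (row_mx x a) /\ Gc (row_mx x b) /\ Gr (row_mx x z) /\
    0 < z 0 0 /\ \sum_i (a 0 i - b 0 i) ^+ 2 < z 0 0 ^+ 2].
  apply: definable_ex; apply: definable_ex; apply: definable_ex.
  apply: definable_and; first by apply: definable_row_in => //; polynomiality.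
  apply: definable_and; first by apply: definable_row_in => //; polynomiality.
  apply: definable_and; first by apply: definable_row_in => //; polynomiality.
  by apply: definable_and; apply: definable_lt; polynomiality.
(* The bounds on [t] are built in because the graphs of the representatives are definable only over
   these intervals. *)
pose P t := (0 < t < e1 /\ 0 < t < e2 /\ 0 < t < e3) /\
  enorm (germ_fun y t - germ_fun c t) < germ_fun r t 0 0.
have /definable_near0[] : definable S [set x : 'rV[R]_1 | P (x 0 0)].
- apply: definable_eq SP; apply/seteqP; split=> x /=.
    move=> [a [b [z]]] [/curve_graphE[? ->]] [/curve_graphE[? ->]].
    move=> [/curve_graphE[? ->]] [z0]; rewrite sum_sqrB => abz.
    by rewrite /P enorm_lt z0.
  move=> [[x1 [x2 x3]]]; rewrite enorm_lt => /andP[z0 yc].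
  exists (germ_fun y (x 0 0)), (germ_fun c (x 0 0)), (germ_fun r (x 0 0)).
  by rewrite sum_sqrB; do 3 (split; first exact/curve_graphE).
- by apply: filterS => t [].
- move=> nP; case: yrE; near=> t; apply/eqP; rewrite eq_le; apply/andP; split.
    by near: t.
  rewrite leNgt; apply/negP => yct.
  have : ~ P t by near: t.
  apply; split=> //.
  have t0 : 0 < t by near: t; exact: nbhs_right_gt.
  by rewrite t0/=; do 2 ?split; near: t; exact: nbhs_right_lt.
Unshelve. all: by end_near. Qed.

Lemma germ_lt_near (u v : R -> R) :
  (\forall t \near 0^'+, u t < v t) -> germ_lt u v.
Proof.
move=> uv; split; first by apply: filterS uv => t /ltW.
move=> uvE; have [t [uvt uvEt]] := @filter_ex _ (0 : R)^'+ _ _ (filterI uv uvE).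
by move: uvt; rewrite uvEt ltxx.
Qed.

Lemma near0_itv (e : R) : 0 < e -> \forall t \near 0^'+, 0 < t < e.
Proof.
by move=> e0; near=> t; apply/andP; split; near: t;
  [exact: nbhs_right_gt|exact: nbhs_right_lt].
Unshelve. all: by end_near. Qed.

(** Choose representatives on a common interval, apply [exists_radius] there, and take the germ of
    the resulting curve as radius. *)
Lemma tilde_ball n m (X : set 'rV[R]_n) (Y : set 'rV[R]_m) f
    (hf : cont_definable_map S X Y f) (g : germ S n) (gX : tilde X g)
    (c : germ S m) (r : germ S 1) : germ_ball c r (tilde_comp hf gX) ->
  exists d : germ S 1, [/\ germ_lt (fun=> 0) (fun t => germ_fun d t 0 0) &
    forall (b : germ S n) (bX : tilde X b),
      germ_ball g d b -> germ_ball c r (tilde_comp hf bX)].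
Proof.
move=> /germ_ball_near gcr.
have [e1 e10 gP] := curveP (repr g); have [e2 e20 cP] := curveP (repr c).
have [e3 e30 rP] := curveP (repr r).
have : \forall t \near 0^'+, X (germ_fun g t) /\
    enorm (f (germ_fun g t) - germ_fun c t) < germ_fun r t 0 0.
  have gE := tilde_compE hf gX.
  by near=> t; split; [near: t|rewrite -(near gE t)//; near: t].
move=> [e4 /= e40 e4P].
pose e := Num.min (Num.min e1 e2) (Num.min e3 e4).
have e0 : 0 < e by rewrite !lt_min e10 e20 e30 e40.
have e4P' t : 0 < t < e -> X (germ_fun g t) /\
    enorm (f (germ_fun g t) - germ_fun c t) < germ_fun r t 0 0.
  rewrite !lt_min => /and3P[t0 _ /andP[_ t4]]; apply: e4P => //=.
  by rewrite sub0r normrN gtr0_norm.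
have [d dP dE] : exists2 d : R -> 'rV[R]_1, cont_definable_on S e d &
    forall t, 0 < t < e -> 0 < d t 0 0 /\
      forall b, X b -> enorm (b - germ_fun g t) <= d t 0 0 ->
        enorm (f b - germ_fun c t) < germ_fun r t 0 0.
  apply: (exists_radius hf).
  - by apply: cont_definable_on_sub gP _; rewrite !ge_min lexx.
  - by apply: cont_definable_on_sub cP _; rewrite !ge_min lexx orbT.
  - by apply: cont_definable_on_sub rP _; rewrite !ge_min lexx !orbT.
  - by move=> t /e4P'[].
  - by move=> t /e4P'[].
have dcurve : exists2 e, 0 < e & cont_definable_on S e d by exists e.
exists (\pi_(germ S 1) (Curve dcurve)).
have piE := germ_funP (Curve dcurve).
have te := near0_itv e0.
split.
  by apply: germ_lt_near; apply: filterS2 piE te => t -> /dE[].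
(* The weak half of [germ_lt] is enough, since [exists_radius] controls closed balls. *)
move=> b bX [bg _]; apply: germ_lt_near.
have bE := tilde_compE hf bX; have bX' := bX.
near=> t; rewrite (near bE t)//.
have t0e : 0 < t < e by near: t.
apply: (dE t t0e).2; first by near: t.
rewrite -[d]/(curve_fun (Curve dcurve)) -(near piE t)//.
by near: t.
Unshelve. all: by end_near. Qed.

End Germs.

Theorem corollary3p6 (R : rcfType) (S : omin R) (n m : nat)
    (X : set 'rV[R]_n) (Y : set 'rV[R]_m)
    (defX : definable S X) (defY : definable S Y) (lcX : locally_closed X)
    (f : 'rV[R]_n -> 'rV[R]_m) (hf : cont_definable_map S X Y f) :
  continuous (hat_map hf).
Proof.
(* The target carries the topology induced from germs, so continuity is tested after the inclusion,
   on balls around the image. *)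
apply: continuous_comp_initial => g; apply: cvg_germ => [|c r gcr].
  by apply: fmap_filter; exact: (@nbhs_filter (hat X) g).
have [d [d0 dP]] := tilde_ball gcr.
have gd : nbhs (val g) (germ_ball (val g) d).
  apply: open_nbhs_nbhs; split; first exact: germ_ball_open.
  rewrite /germ_ball /=.
  by under eq_fun do rewrite subrr enorm0.
(* The ball around [g] is pulled back along the inclusion to a neighbourhood in [hat X]. *)
apply: (@filterS _ _ (@nbhs_filter (hat X) g)) (initial_continuous gd) => b.
exact: dP.
Qed.
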